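(* Let $G=(V,E)$ be a cocomparability graph, let $\sigma$ be an LDFS umbrella-free ordering of $V$, and let $P$ be a maximal path of $G$. Then there exists a normal path $P'$ of $G$ (with respect to $\sigma$) such that $V(P')=V(P)$.
   Context: Graphs are finite, simple, undirected; $N(v)$ denotes the neighborhood of $v$. A path $P=(v_1,\dots,v_k)$ is a sequence of distinct vertices with $v_iv_{i+1}\in E$; $V(P)$ is its vertex set. A path $P$ is maximal if there is no path $P'$ with $V(P)\subsetneq V(P')$. An ordering $\sigma$ of $V$ is umbrella-free if for all $x<_\sigma y<_\sigma z$, $xz\in E$ implies $xy\in E$ or $yz\in E$. For an ordering $\sigma$, a triple $(a,b,c)$ with $a<_\sigma b<_\sigma c$, $ac\in E$, $ab\notin E$ is good if there is a vertex $d$ with $a<_\sigma d<_\sigma b$, $db\in E$, $dc\notin E$ (such $d$ is a $d$-vertex of the triple), and bad otherwise; $\sigma$ is an LDFS ordering if it has no bad triple. A path $P=(v_1,\dots,v_k)$ is typical (w.r.t. $\sigma$) if $v_1$ is the rightmost vertex of $V(P)$ in $\sigma$ and $v_2$ is the rightmost vertex of $N(v_1)\cap V(P)$ in $\sigma$; a typical path is normal if, for every $i=2,\dots,k$, $v_i$ is the rightmost vertex of $N(v_{i-1})\cap\{v_i,v_{i+1},\dots,v_k\}$ in $\sigma$. *)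

(* Defs.v *)
From mathcomp Require Import all_boot.

Set Implicit Arguments.
Unset Strict Implicit.
Unset Printing Implicit Defensive.

Section Graphs.

Variable V : finType.

Definition simple_graph (e : rel V) : Prop := symmetric e /\ irreflexive e.

Definition complement (e : rel V) : rel V := [rel x y | (x != y) && ~~ e x y].

(* The strict partial order [o] is the transitive orientation of the edges. *)
Definition comparability_graph (g : rel V) : Prop :=
  exists o : rel V,
    [/\ irreflexive o, transitive o & forall x y, g x y = o x y || o y x].

Definition cocomparability_graph (e : rel V) : Prop :=
  comparability_graph (complement e).

Definition nbh (e : rel V) (v : V) : {set V} := [set w | e v w].

(* A path (v_1, ..., v_k) has k >= 1 vertices; the adjacency predicate [path]
   of the library does not require them to be distinct. *)
Definition is_path (e : rel V) (P : seq V) : bool :=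
  if P is v :: p then path e v p && uniq P else false.

Definition vset (P : seq V) : {set V} := [set x in P].

Definition maximal_path (e : rel V) (P : seq V) : Prop :=
  is_path e P /\
  ~ exists P' : seq V, is_path e P' /\ vset P \proper vset P'.

(* An ordering of V is given by its strict relation: [lt x y] means that x is
   to the left of y. *)
Definition vertex_ordering (lt : rel V) : Prop :=
  [/\ irreflexive lt, transitive lt & forall x y, x != y -> lt x y || lt y x].

Definition umbrella_free (e lt : rel V) : Prop :=
  forall x y z, lt x y -> lt y z -> e x z -> e x y || e y z.

Definition triple (e lt : rel V) (a b c : V) : Prop :=
  [/\ lt a b, lt b c, e a c & ~~ e a b].

Definition d_vertex (e lt : rel V) (a b c d : V) : Prop :=
  [/\ lt a d, lt d b, e d b & ~~ e d c].

Definition good_triple (e lt : rel V) (a b c : V) : Prop :=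
  triple e lt a b c /\ exists d, d_vertex e lt a b c d.

Definition bad_triple (e lt : rel V) (a b c : V) : Prop :=
  triple e lt a b c /\ ~ good_triple e lt a b c.

Definition LDFS_ordering (e lt : rel V) : Prop :=
  vertex_ordering lt /\ ~ exists a b c, bad_triple e lt a b c.

Definition rightmost (lt : rel V) (A : {set V}) (v : V) : Prop :=
  v \in A /\ forall w, w \in A -> w != v -> lt w v.

(* The condition on v_2 is void for a one-vertex path. *)
Definition typical_path (e lt : rel V) (P : seq V) : Prop :=
  is_path e P /\
  match P with
  | [::] => False
  | v1 :: p =>
      rightmost lt (vset P) v1 /\
      (if p is v2 :: _ then rightmost lt (nbh e v1 :&: vset P) v2 else True)
  end.

(* Indices start at 1 as in (v_1, ..., v_k), so v_i is [nth x0 P i.-1] and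
   {v_i, ..., v_k} is the vertex set of [drop i.-1 P]; the default x0 is
   never reached. *)
Definition normal_path (e lt : rel V) (P : seq V) : Prop :=
  typical_path e lt P /\
  forall (x0 : V) (i : nat), 2 <= i <= size P ->
    rightmost lt (nbh e (nth x0 P i.-2) :&: vset (drop i.-1 P))
              (nth x0 P i.-1).

End Graphs.

(* Main.v *)
Require Import Defs.
From mathcomp Require Import all_boot.

(** Non-adjacent vertices, ordered by sigma, form a partial order [prec], of
    which sigma is a linear extension.  The path is made greedy from its first
    vertex on.  At each stage the remaining vertices carry a path whose first
    vertex is constrained to a set [U] (everything, or the neighborhood of the
    previous vertex) that is upward closed for [prec].  By reversing segments
    this path is first turned into a decreasing linear extension of [prec]; let
    [w] be the rightmost vertex of [U] in it.  Reverse the initial segment ending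
    at [w].  If its last vertex [a] is not adjacent to the next vertex [z], then
    [(z, a, w)] is a triple and its d-vertex [d] is adjacent to both [a] and [z].
    By maximality of the path [d] lies on it, and after [z] since [prec d w];
    so reverse the segment from [z] to [d] and go on with [z, d] in place of
    [a, w]. *)

Section Greedy.

Variables (V : finType) (e lt : rel V).
Hypotheses (eC : symmetric e) (ltxx : irreflexive lt) (lt_trans : transitive lt).
Hypothesis lt_total : forall x y, x != y -> lt x y || lt y x.
Hypothesis umbrella : umbrella_free e lt.
Hypothesis ldfs : forall a b c, lt a b -> lt b c -> e a c -> ~~ e a b ->
  exists d, [/\ lt a d, lt d b, e d b & ~~ e d c].

Implicit Types (U W : pred V) (Q R s t p : seq V).

(** * The partial order of non-adjacency *)

Definition prec : rel V := [rel x y | lt x y && ~~ e x y].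

Lemma prec_lt x y : prec x y -> lt x y.
Proof. by case/andP. Qed.

Lemma prec_adj x y : prec x y -> ~~ e x y.
Proof. by case/andP. Qed.

Lemma precxx x : prec x x = false.
Proof. by rewrite /prec /= ltxx. Qed.

(** Two consecutive non-edges closed by an edge would form an umbrella. *)
Lemma prec_trans : transitive prec.
Proof.
move=> y x z /andP[xy nxy] /andP[yz nyz]; apply/andP; split.
  exact: lt_trans xy yz.
by apply/negP => /(umbrella _ _ _ xy yz); rewrite (negPf nxy) (negPf nyz).
Qed.

Lemma adj_or_prec x y : x != y -> [|| e x y, prec x y | prec y x].
Proof.
move=> /lt_total; rewrite /prec /= (eC y x).
by case: (e x y) => //=; rewrite !andbT.
Qed.

(** [U] constrains the start: [predT] for a free path, [e v] for a continuation after [v], which may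
    be empty. *)
Definition upath U s : bool :=
  if s is x :: p then U x && path e x p else true.

Definition up_closed U Q : Prop :=
  forall x y, x \in Q -> y \in Q -> U x -> prec x y -> U y.

Lemma up_closed_perm U Q R : perm_eq R Q -> up_closed U Q -> up_closed U R.
Proof. by move=> eqRQ upU x y; rewrite !(perm_mem eqRQ); apply: upU. Qed.

(** If [e x y] and [prec y z] but [x], [z] are not adjacent, the maximality of [x] leaves
    [prec z x], hence [prec y x], against the edge. *)
Lemma up_closed_nbh x p :
  (forall y, y \in p -> ~~ prec x y) -> up_closed (e x) p.
Proof.
move=> xmax y z _ zp exy yz.
have nzx : ~~ prec z x.
  by apply/negP => /(prec_trans _ _ _ yz)/prec_adj; rewrite eC exy.
have nxz : x != z by apply/eqP => xz; move: (prec_adj _ _ yz); rewrite -xz eC exy.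
by have := adj_or_prec _ _ nxz; rewrite (negPf nzx) (negPf (xmax z zp)) !orbF.
Qed.

(** * Reordering a path decreasingly *)

Lemma path_rev x s y : path e x (rcons s y) -> path e y (rcons (rev s) x).
Proof.
have := rev_path e x (rcons s y); rewrite last_rcons belast_rcons rev_cons => ->.
by apply: sub_path => u v /=; rewrite eC.
Qed.

Lemma split_last (P : pred V) p : has P p ->
  exists s y t, [/\ p = s ++ y :: t, P y & ~~ has P t].
Proof.
elim: p => //= x p IH; case: (boolP (has P p)) => [/IH [s [y [t [-> Py nt]]]] _|].
  by exists (x :: s), y, t.
by rewrite orbF => np Px; exists [::], x, p.
Qed.

(** If [x] is below some vertex of [p], let [y] be the last such vertex and reverse the segment from
    [x] to [y]. The new head has fewer vertices to its right, which is the induction measure. *)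
Lemma upath_max_head U x p : uniq (x :: p) -> upath U (x :: p) ->
    up_closed U (x :: p) ->
  exists y q, [/\ perm_eq (y :: q) (x :: p), upath U (y :: q) &
                  ~~ has (prec y) q].
Proof.
have [n] := ubnP (count (lt x) (x :: p)).
elim: n x p => // n IH x p le_n Up pathp upU.
have [/split_last[s [y [t [defp xy nt]]]]|] := boolP (has (prec x) p);
  last by exists x, p.
have eqp : perm_eq (y :: rcons (rev s) x ++ t) (x :: p).
  rewrite defp -rev_cons -cat_cons -[y :: t]/([:: y] ++ t) perm_sym.
  by rewrite (perm_catCA (x :: s) [:: y]) (perm_cons y ((x :: s) ++ t)) perm_cat2r perm_sym perm_rev.
have [] := IH y (rcons (rev s) x ++ t).
- rewrite (permP eqp) -ltnS (leq_trans _ le_n) // !ltnS.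
  have -> : count (lt x) (x :: p) = count (lt y) (x :: p)
      + count (predD (lt x) (lt y)) (x :: p).
    rewrite -count_predUI [X in _ + X](@eq_count _ _ pred0) => [|z /=]; last first.
      by case: (lt y z).
    rewrite count_pred0 addn0.
    apply: eq_count => z /=; case: (boolP (lt y z)) => //= yz.
    exact: lt_trans (prec_lt _ _ xy) yz.
  rewrite -[X in X < _]addn0 ltn_add2l -has_count; apply/hasP; exists y.
    by rewrite defp inE mem_cat mem_head !orbT.
  by rewrite /= ltxx prec_lt.
- by rewrite (perm_uniq eqp).
- move: pathp; rewrite defp /= -cat_rcons cat_path last_rcons.
  case/and3P=> Ux exy pyt; rewrite cat_path last_rcons path_rev //=.
  rewrite (upU x y) ?mem_head //=; last by rewrite defp inE mem_cat mem_head !orbT.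
  (* The vertex [z] after [y] is not above [x]; were it below [x], it would be below its neighbor
     [y]. So [x] is adjacent to [z]. *)
  case: t pyt defp nt {eqp} => //= z t /andP[yz ->] defp; rewrite andbT negb_or.
  case/andP=> nxz _.
  have zx : x != z.
    by apply: contraTneq (prec_adj _ _ xy) => xz; rewrite xz eC yz.
  have := adj_or_prec _ _ zx; rewrite (negPf nxz); case/or3P=> // /prec_trans zx'.
  by have /prec_adj := zx' _ xy; rewrite eC yz.
- exact: up_closed_perm eqp upU.
move=> z [q [eqq pathq zmax]]; exists z, q; split=> //.
exact: perm_trans eqq eqp.
Qed.

Lemma upath_decreasing U Q : uniq Q -> upath U Q -> up_closed U Q ->
  exists R, [/\ perm_eq R Q, upath U R & pairwise [rel x y | ~~ prec x y] R].
Proof.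
have [n] := ubnP (size Q); elim: n U Q => // n IH U [|x p] le_n.
  by exists [::].
move=> Up pathp upU.
have [y [q [eqq /= /andP[Uy pathq] /hasPn ymax]]] :=
  upath_max_head _ _ _ Up pathp upU.
have [||||R [eqR pathR decR]] := IH (e y) q.
- by move: (perm_size eqq) le_n => /= [->].
- by move: Up; rewrite -(perm_uniq eqq) => /andP[].
- by case: (q) pathq.
- exact: up_closed_nbh.
exists (y :: R); split.
- by apply: perm_trans eqq; rewrite perm_cons.
- by rewrite /= Uy; case: (R) pathR.
- rewrite /= decR andbT; apply/allP => z; rewrite (perm_mem eqR).
  exact: ymax.
Qed.

(** * Bringing the rightmost allowed vertex to the front *)

Lemma ex_rightmost U s : has U s ->
  exists w, [/\ w \in s, U w & forall b, b \in s -> U b -> b != w -> lt b w].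
Proof.
elim: s => //= x s IH; have [/IH [w [ws Uw wmax]] _|nU] := boolP (has U s).
  have [Ux|nUx] := boolP (U x); last first.
    exists w; split=> // [|b]; first by rewrite inE ws orbT.
    by rewrite inE => /predU1P[->|/wmax//]; rewrite (negPf nUx).
  have [->|nxw] := eqVneq x w.
    exists w; split=> // [|b]; first exact: mem_head.
    by rewrite inE => /predU1P[->|/wmax//]; rewrite eqxx.
  case/orP: (lt_total _ _ nxw) => [xw|wx].
    exists w; split=> // [|b]; first by rewrite inE ws orbT.
    by rewrite inE => /predU1P[->|/wmax//].
  exists x; split=> // [|b]; first exact: mem_head.
  rewrite inE => /predU1P[->|bs Ub _]; first by rewrite eqxx.
  by have [->//|/(wmax b bs Ub)/lt_trans->] := eqVneq b w.
rewrite orbF => Ux; exists x; split=> // [|b]; first exact: mem_head.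
rewrite inE => /predU1P[->|bs Ub]; first by rewrite eqxx.
by case/negP: nU; apply/hasP; exists b.
Qed.

(** [W] holds the vertices not yet placed; comparing only with paths inside it lets maximality pass
    to tails. *)
Definition maximal_in U W Q : Prop :=
  forall R, uniq R -> {subset R <= W} -> upath U R ->
    {subset Q <= R} -> {subset R <= Q}.

(** [w :: D] is the block already rearranged, [T] the part still to attach. [T] continues the anchor
    [d], not necessarily the end of the block: at first [d] is [w], later the last d-vertex
    found. *)
Lemma block_reversal U W Q w D d T :
    uniq Q -> {subset Q <= W} -> maximal_in U W Q ->
    (forall x y, y \in Q -> prec x y -> x \in W) ->
    U w -> perm_eq (w :: D ++ T) Q ->
    path e w D -> upath (e d) T -> pairwise [rel x y | ~~ prec x y] T ->
    d \in Q -> lt (last w D) d ->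
    (forall y, y \in T -> ~~ prec (last w D) y) ->
    (forall x, x \in Q -> prec x d -> x \in T) ->
  exists R, perm_eq (w :: R) Q /\ path e w R.
Proof.
move=> uQ QW maxQ downW Uw.
have [n] := ubnP (size T); elim: n T D d => // n IH [|z T] D d le_n eqQ pathD.
  by exists D; rewrite cats0 in eqQ.
set a := last w D => /= /andP[edz pathT] /andP[/allP zT decT] dQ ad aT dT.
have [eaz|naz] := boolP (e a z).
  by exists (D ++ z :: T); split=> //; rewrite cat_path pathD /= -/a eaz.
have uDT : uniq (w :: D ++ z :: T) by rewrite (perm_uniq eqQ).
have nza : z != a.
  apply/eqP => za; move: uDT; rewrite -cat_cons cat_uniq => /and3P[_ /hasPn/(_ z)].
  by rewrite mem_head za /a mem_last => /(_ isT).
have za : prec z a.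
  have := adj_or_prec _ _ nza; rewrite eC (negPf naz) (negPf (aT z _)) ?orbF //.
  exact: mem_head.
have [|d' [zd' d'a ed'a nd'd]] :=
  ldfs _ _ _ (prec_lt _ _ za) ad _ (prec_adj _ _ za); first by rewrite eC.
have d'd : prec d' d by rewrite /prec /= nd'd (lt_trans _ _ _ d'a ad).
have ed'z : e d' z.
  rewrite eC; apply/negPn/negP => nzd'.
  have /prec_adj : prec z d by apply: prec_trans d'd; rewrite /prec /= zd'.
  by rewrite eC edz.
(* Otherwise [d'] fits between [a] and [z], giving a larger path inside [W] from [w]. *)
have d'Q : d' \in Q.
  apply/negPn/negP => nd'Q; move: (nd'Q); apply/negP/negPn.
  have eqR : perm_eq (w :: D ++ d' :: z :: T) (d' :: Q).
    by rewrite -cat_cons (perm_catCA (w :: D) [:: d']) /= perm_cons.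
  apply: (maxQ (w :: D ++ d' :: z :: T)).
  - by rewrite (perm_uniq eqR) /= nd'Q.
  - move=> x; rewrite (perm_mem eqR) inE => /predU1P[->|/QW//].
    exact: downW dQ d'd.
  - by rewrite /= Uw cat_path pathD /= -/a eC ed'a ed'z.
  - by move=> x xQ; rewrite (perm_mem eqR) inE xQ orbT.
  - by rewrite (perm_mem eqR) mem_head.
have d'T : d' \in T.
  have := dT d' d'Q d'd; rewrite inE => /predU1P[d'z|//].
  by rewrite d'z ltxx in zd'.
case/splitPr: T / d'T le_n eqQ pathT zT decT aT dT uDT => t1 t2 le_n eqQ.
rewrite -cat_rcons cat_path last_rcons pairwise_cat pairwise_rcons.
move=> /andP[pt1 pt2] zT /and3P[/allrelP dec12 /andP[/allP dec1 _] decT] aT dT uDT.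
apply: (IH t2 (D ++ d' :: rcons (rev t1) z) d').
- rewrite -ltnS; apply: leq_trans le_n.
  by rewrite /= size_cat /= addnS !ltnS leqW ?leq_addl.
- apply: perm_trans eqQ; rewrite perm_cons -catA perm_cat2l /= -rev_cons.
  rewrite perm_sym -cat_cons (perm_catCA (z :: t1) [:: d']) (perm_cons d' ((z :: t1) ++ t2)) perm_cat2r.
  by rewrite perm_sym perm_rev.
- by rewrite cat_path pathD /= -/a eC ed'a /= path_rev.
- by case: (t2) pt2.
- exact: decT.
- exact: d'Q.
- by rewrite last_cat /= last_rcons.
- rewrite last_cat /= last_rcons => y yt2; apply: zT.
  by rewrite mem_cat yt2 orbT.
(* A vertex below [d'] is below [d], hence in [z :: t1 ++ d' :: t2]. Since this list is decreasing,
   it can only lie in [t2]. *)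
- move=> x xQ xd'; have := dT x xQ (prec_trans _ _ _ xd' d'd).
  rewrite inE mem_cat mem_rcons inE => /or3P[/eqP xz|/predU1P[xd|xt1]|//].
  + by move: (zT d'); rewrite mem_cat mem_rcons mem_head /= -xz xd' => /(_ isT).
  + by rewrite xd precxx in xd'.
  + by move: (dec1 x xt1); rewrite /= xd'.
Qed.

(** * Greedy paths and normality *)

Fixpoint greedy U s : Prop :=
  if s is w :: q then
    [/\ U w, forall b, b \in q -> U b -> lt b w & greedy (e w) q]
  else True.

Lemma greedy_exists U W Q :
    uniq Q -> {subset Q <= W} -> upath U Q -> up_closed U Q ->
    (forall x y, y \in Q -> prec x y -> x \in W) -> maximal_in U W Q ->
  exists R, perm_eq R Q /\ greedy U R.
Proof.
have [n] := ubnP (size Q); elim: n U W Q => // n IH U W Q le_n.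
case: (posnP (size Q)) => [/size0nil-> *|Q_gt0]; first by exists [::].
move=> uQ QW pathQ upU downW maxQ.
have hasU : has U Q by case: (Q) Q_gt0 pathQ => //= x p _ /andP[->].
have [w [wQ Uw wmax]] := ex_rightmost _ _ hasU.
(* Up-closure of [U] makes [w] maximal in [Q]. For the tail this gives the up-closure of [e w] and
   keeps all lower vertices in the smaller [W]. *)
have wtop x : x \in Q -> ~~ prec w x.
  move=> xQ; apply/negP => wx; have Ux := upU _ _ wQ xQ Uw wx.
  have xw : x != w by apply: contraTneq wx => ->; rewrite precxx.
  by have := lt_trans _ _ _ (wmax x xQ Ux xw) (prec_lt _ _ wx); rewrite ltxx.
have [q [eqq pathq]] : exists q, perm_eq (w :: q) Q /\ path e w q.
  have [R [eqR pathR decR]] := upath_decreasing _ _ uQ pathQ upU.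
  have wR : w \in R by rewrite (perm_mem eqR).
  case/splitPr: R / wR eqR pathR decR => [[|a s] t] eqR.
    by case/andP=> _ pathR _; exists t.
  rewrite -cat_rcons [upath _ _]/= cat_path last_rcons pairwise_cat pairwise_rcons.
  case/and3P=> Ua pas pt /and3P[/allrelP decst /andP[/allP decs _] dect].
  have aQ : a \in Q by rewrite -(perm_mem eqR) mem_head.
  have naw : a != w.
    apply: contraTneq uQ => aw.
    by rewrite -(perm_uniq eqR) /= mem_cat aw mem_head orbT.
  (* The block is the reversed initial segment; the anchor is [w], which preceded [t]. *)
  apply: (block_reversal U W Q w (rcons (rev s) a) w t) => //.
  - apply: perm_trans eqR; rewrite -rev_cons -cat_cons perm_sym perm_catC /=.
    by rewrite perm_cons perm_catC perm_cat2r perm_sym perm_rev.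
  - exact: path_rev.
  - by case: (t) pt.
  - by rewrite last_rcons wmax.
  - rewrite last_rcons => y yt; apply: decst => //.
    by rewrite mem_rcons inE mem_head orbT.
  - move=> x; rewrite -(perm_mem eqR) mem_cat inE => /or3P[xs|/eqP->|//] xw.
      by move: (decs x xs); rewrite /= xw.
    by rewrite precxx in xw.
have /= /andP[wq uq] : uniq (w :: q) by rewrite (perm_uniq eqq).
have qQ x : x \in q -> x \in Q by rewrite -(perm_mem eqq) inE orbC => ->.
have [|||||||R [eqR gR]] := IH (e w) [pred x in W | x != w] q.
- by rewrite -ltnS (leq_trans _ le_n) // ltnS -(perm_size eqq).
- by [].
- move=> x xq; rewrite !inE (QW x (qQ x xq)).
  by apply: contraNneq wq => <-.
- by case: (q) pathq.
- by apply: up_closed_nbh => y /qQ/wtop.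
- move=> x y yq xy; rewrite inE /= (downW x y (qQ y yq) xy) /=.
  by apply: contraTneq xy => ->; apply/wtop/qQ.
(* A path competing with [q] avoids [w], so prefixing [w] gives one competing with [Q]. *)
- move=> R uR RW pathR qR x xR.
  have wR : w \notin R by apply/negP => /RW; rewrite !inE eqxx andbF.
  have : x \in Q.
    apply: (maxQ (w :: R)); rewrite ?inE ?xR ?orbT //=.
    + by rewrite wR.
    + by move=> y; rewrite inE => /predU1P[->|/RW/andP[]//]; apply: QW.
    + by rewrite Uw; case: (R) pathR.
    + move=> y; rewrite -(perm_mem eqq) !inE => /predU1P[->|/qR->].
        by rewrite eqxx.
      by rewrite orbT.
  rewrite -(perm_mem eqq) inE => /predU1P[xw|//].
  by rewrite -xw xR in wR.
exists (w :: R); split; first by apply: perm_trans eqq; rewrite perm_cons.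
split=> // b; rewrite (perm_mem eqR) => bq Ub; apply: wmax => //; first exact: qQ.
by apply: contraNneq wq => <-.
Qed.

Lemma greedy_path x p : greedy (e x) p -> path e x p.
Proof. by elim: p x => //= y p IH x [-> _ /IH]. Qed.

Lemma greedy_nth x0 x p i : greedy (e x) p -> i < size p ->
  rightmost lt (nbh e (nth x0 (x :: p) i) :&: vset (drop i p)) (nth x0 p i).
Proof.
elim: p x i => // y p IH x [|i] [exy ymax gp] ip; last exact: IH.
split; first by rewrite !inE exy eqxx.
move=> w; rewrite !inE => /andP[exw /predU1P[->|wp _]]; first by rewrite eqxx.
exact: ymax.
Qed.

Lemma greedy_normal P : irreflexive e -> uniq P -> greedy predT P -> 0 < size P ->
  normal_path e lt P.
Proof.
case: P => // v p exx uP [_ vmax gp] _; split; last first.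
  by move=> x0 [|[|i]] //= ip; apply: greedy_nth.
split; first by rewrite /is_path greedy_path.
split.
  split=> [|w]; first by rewrite inE mem_head.
  by rewrite !inE => /predU1P[->|/vmax-> //]; rewrite eqxx.
case: p uP vmax gp => // u p uP vmax gp.
(* Typicality ranges over the whole vertex set, greediness over the tail; they differ by [v], which
   is not its own neighbor. *)
have [umem umax] := greedy_nth v v (u :: p) 0 gp isT.
split; first by move: umem; rewrite !inE => /andP[-> /= ->]; rewrite orbT.
move=> w; rewrite !inE => /andP[evw]; case/predU1P => [wv|wp wu].
  by rewrite wv exx in evw.
by apply: umax; rewrite // !inE evw.
Qed.

End Greedy.

Theorem theorem2 (V : finType) (e : rel V) (sigma : rel V) (P : seq V)
  (e_simple : simple_graph e)
  (e_cocomp : cocomparability_graph e)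
  (sigma_LDFS : LDFS_ordering e sigma)
  (sigma_umbrella_free : umbrella_free e sigma)
  (P_maximal : maximal_path e P) :
  exists P' : seq V, normal_path e sigma P' /\ vset P' = vset P.
Proof.
have [eC exx] := e_simple; have [[ltxx lt_trans lt_total] no_bad] := sigma_LDFS.
have [pathP maxP] := P_maximal.
have ldfs a b c : sigma a b -> sigma b c -> e a c -> ~~ e a b ->
    exists d, [/\ sigma a d, sigma d b, e d b & ~~ e d c].
  move=> ab bc ac nab.
  (* Finiteness of [V] makes the existence of a d-vertex decidable, so excluding bad triples
     produces one. *)
  have [/existsP[d /and4P[]]|no_d] :=
    boolP [exists d, [&& sigma a d, sigma d b, e d b & ~~ e d c]].
    by exists d.
  case: no_bad; exists a, b, c; split=> // -[_ [d [ad db edb ndc]]].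
  by case/existsP: no_d; exists d; rewrite ad db edb.
have uP : uniq P by case: (P) pathP => // v p /andP[].
have P_gt0 : 0 < size P by case: (P) pathP.
have [|||||R [eqR gR]] := greedy_exists V e sigma eC ltxx lt_trans lt_total
    sigma_umbrella_free ldfs predT predT P uP.
- by [].
- by case: (P) pathP => // v p /andP[].
- by [].
- by [].
- move=> R uR _ pathR PR x xR; apply/negPn/negP => nxP; case: maxP.
  exists R; split; first by case: (R) xR uR pathR => // v p _ uR /= ->.
  apply/properP; split; first by apply/subsetP => y; rewrite !inE => /PR.
  by exists x; rewrite !inE.
exists R; split; last by apply/setP => x; rewrite !inE (perm_mem eqR).
apply: greedy_normal => //; first by rewrite (perm_uniq eqR).
by rewrite (perm_size eqR).
Qed.
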